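(* Let $\alpha\ge k\ge 2$ be integers, let $H=(V,E)$ be a graph with $\alpha(H)=k$, and let $G=H\oplus\overline{K_{\alpha-k}}$ be the graph obtained from $H$ by adding $\alpha-k$ isolated nodes. Assume that $\vartheta\text{-rank}(H\setminus i^\perp)=0$ for all $i\in V$ and that $\vartheta\text{-rank}(H)=1$. In addition assume that $\alpha\le \frac{k(k+3)}{k-1}$. Then $\vartheta\text{-rank}(G)=1$.
   Context: All graphs are finite and simple. For a graph $G=(V=[n],E)$, $\alpha(G)$ is the maximum cardinality of a stable (independent) set, $A_G$ is the adjacency matrix, $I$ the identity and $J$ the all-ones matrix. For a node $i$, $i^\perp=\{i\}\cup N(i)$ is its closed neighborhood, and $H\setminus i^\perp$ is the subgraph of $H$ induced by $V\setminus i^\perp$ (if $V\setminus i^\perp=\emptyset$, the condition $\vartheta\text{-rank}(H\setminus i^\perp)=0$ is regarded as satisfied). For $r\in\mathbb N=\{0,1,\dots\}$, $\mathcal K_n^{(r)}$ is the set of real symmetric $n\times n$ matrices $M$ such that $(\sum_{i=1}^n x_i^2)^r\sum_{i,j=1}^n M_{ij}x_i^2x_j^2$ is a sum of squares of real polynomials. The $\vartheta$-rank of $G$, $\vartheta\text{-rank}(G)$, is the smallest $r\in\mathbb N$ with $\alpha(G)(A_G+I)-J\in\mathcal K_n^{(r)}$, and $\infty$ if no such $r$ exists. $\oplus$ denotes disjoint union of graphs and $\overline{K_m}$ is the graph consisting of $m$ isolated nodes. *)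

(* Defs.v *)
From HB Require Import structures.
From mathcomp Require Import all_boot all_order all_algebra.
From mathcomp Require Import boolp reals.
From mathcomp Require Import mpoly.

Set Implicit Arguments.
Unset Strict Implicit.
Unset Printing Implicit Defensive.

Import Order.TTheory GRing.Theory Num.Theory.
Local Open Scope ring_scope.

Record sgraph := SGraph {
  vertex :> finType;
  edge : rel vertex;
  edge_sym : ssrbool.symmetric edge;
  edge_irr : ssrbool.irreflexive edge }.

Section Graphs.
Variable G : sgraph.

Definition stable (S : {set G}) : bool :=
  [forall x in S, forall y in S, ~~ edge x y].

Definition alpha : nat := \max_(S : {set G} | stable S) #|S|.

Definition closed_nbhd (i : G) : {set G} := i |: [set j | edge i j].

Section Induced.
Variable S : {set G}.

Definition induced_edge : rel {x : G | x \in S} :=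
  fun x y => edge (val x) (val y).

Lemma induced_edge_sym : ssrbool.symmetric induced_edge.
Proof. by move=> x y; apply: edge_sym. Qed.

Lemma induced_edge_irr : ssrbool.irreflexive induced_edge.
Proof. by move=> x; apply: edge_irr. Qed.

Definition induced : sgraph := SGraph induced_edge_sym induced_edge_irr.

End Induced.

Definition del_closed_nbhd (i : G) : sgraph := induced (~: closed_nbhd i).

End Graphs.

Section DisjointUnion.
Variables G1 G2 : sgraph.

Definition dunion_edge : rel (G1 + G2)%type := fun x y =>
  match x, y with
  | inl x1, inl y1 => edge x1 y1
  | inr x2, inr y2 => edge x2 y2
  | _, _ => false
  end.

Lemma dunion_edge_sym : ssrbool.symmetric dunion_edge.
Proof. by move=> [x|x] [y|y] //=; apply: edge_sym. Qed.

Lemma dunion_edge_irr : ssrbool.irreflexive dunion_edge.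
Proof. by move=> [x|x] /=; apply: edge_irr. Qed.

Definition dunion : sgraph := SGraph dunion_edge_sym dunion_edge_irr.

End DisjointUnion.

Section Edgeless.
Variable m : nat.

Definition edgeless_edge : rel 'I_m := fun _ _ => false.

Lemma edgeless_edge_sym : ssrbool.symmetric edgeless_edge.
Proof. by []. Qed.

Lemma edgeless_edge_irr : ssrbool.irreflexive edgeless_edge.
Proof. by []. Qed.

Definition edgeless : sgraph := SGraph edgeless_edge_sym edgeless_edge_irr.

End Edgeless.

Section ThetaRank.
Variable R : realType.

Definition sos n (p : {mpoly R[n]}) : Prop :=
  exists s : seq {mpoly R[n]}, p = \sum_(q <- s) q ^+ 2.

Definition Kcone n (r : nat) (M : 'M[R]_n) : Prop :=
  M^T = M /\
  sos ((\sum_(i < n) 'X_i ^+ 2) ^+ r *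
       \sum_(i < n) \sum_(j < n) M i j *: ('X_i ^+ 2 * 'X_j ^+ 2)).

(* [G] has an arbitrary finite vertex type, numbered here through [enum_val]. *)
Definition adjacency (G : sgraph) : 'M[R]_#|G| :=
  \matrix_(i, j) (edge (enum_val i) (enum_val j))%:R.

Definition graph_matrix (G : sgraph) : 'M[R]_#|G| :=
  (alpha G)%:R *: (adjacency G + 1%:M) - const_mx 1.

(* [None] stands for infinity. *)
Definition theta_rank (G : sgraph) : option nat :=
  match pselect (exists r, `[< Kcone r (graph_matrix G) >]) with
  | left ex_r => Some (ex_minn ex_r)
  | right _ => None
  end.

(* No special case is needed for an empty [del_closed_nbhd i]. *)
Lemma theta_rank_empty (G : sgraph) : #|G| = 0%N -> theta_rank G = Some 0%N.
Proof.
move=> G0.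
have K0 : Kcone 0 (graph_matrix G).
  have no_ord (i : 'I_#|G|) : False by case: i; rewrite G0.
  split; first by apply/matrixP=> i; case: (no_ord i).
  exists [::]; rewrite big_nil [X in _ * X]big1 ?mulr0 // => i; by case: (no_ord i).
rewrite /theta_rank; case: pselect => [ex_r|[]]; last by exists 0%N; apply/asboolP.
by case: ex_minnP => r _ /(_ 0%N (introT (asboolP _) K0)); rewrite leqn0 => /eqP->.
Qed.

End ThetaRank.

(* Main.v *)
Require Import Defs.
From mathcomp Require Import all_boot all_order all_algebra.
From mathcomp Require Import boolp reals mpoly ring zify.

Set Implicit Arguments.
Unset Strict Implicit.
Unset Printing Implicit Defensive.

Import Order.TTheory GRing.Theory Num.Theory.
Local Open Scope ring_scope.

(* Write m = a - k, let f_u (u in H) and y_j (j < m) be the squared variables,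
   s and t their sums, B = A_H + I, X_u the sum of f over the closed neighbourhood
   of u, and D_u the value of B at the restriction of f to the vertices outside it.

   Upper bound.  With q = a (f^T B f + sum y_j^2) - (s + t)^2 one has
     (s + t) q = sum_u f_u P_u + t W + (a^2 / k) N,
   where W is a positive semidefinite form in the k y_j - s, N is the sum of the
   monomials f_u f_v f_w over (u, v, w) with v and w non-adjacent, both in the closed
   neighbourhood of u, and P_u is a sum of squares of forms in
   y_j - X_u and s - k X_u, plus (a^2 / k) (D_u - (s - X_u)^2 / (k - 1)).  This last
   term is a sum of squares because H minus the closed neighbourhood of u has rank 0
   and stability number at most k - 1; the coefficient left over in front of
   (s - k X_u)^2 is nonnegative exactly when (k - 1) m <= 4 k, the assumption on a.

   Lower bound.  If G had rank 0, put all square roots of the y_j equal to one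
   variable Y: the polynomial is even in Y, so the identity p = sum_g g^2 becomes
   p = sum_g (even part of g)^2 + (odd part of g)^2.  Only Y^2 occurs there, and it may
   be replaced by s / k, which is itself a sum of squares.  This turns q into
   (a / k) (k f^T B f - s^2), so H would have rank 0. *)

(** * Sums of squares in commutative rings *)

(** Stated over any commutative ring, unlike [sos], so that certificates can be moved along ring
    morphisms. *)
Definition sumsq {A : comNzRingType} (p : A) : Prop :=
  exists s : seq A, p = \sum_(q <- s) q ^+ 2.

Section SumsOfSquares.
Variable A : comNzRingType.
Implicit Types p q : A.

Lemma sumsq0 : sumsq (0 : A).
Proof. by exists [::]; rewrite big_nil. Qed.

Lemma sumsq_sqr p : sumsq (p ^+ 2).
Proof. by exists [:: p]; rewrite big_seq1. Qed.

Lemma sumsqD p q : sumsq p -> sumsq q -> sumsq (p + q).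
Proof. by move=> [s ->] [t ->]; exists (s ++ t); rewrite big_cat. Qed.

Lemma sumsq_sum (I : Type) (r : seq I) (P : pred I) (F : I -> A) :
  (forall i, P i -> sumsq (F i)) -> sumsq (\sum_(i <- r | P i) F i).
Proof.
by move=> sqF; apply: (big_ind (@sumsq A)) => //; [exact: sumsq0|exact: sumsqD].
Qed.

Lemma sumsqM p q : sumsq p -> sumsq q -> sumsq (p * q).
Proof.
move=> [s ->] [t ->]; rewrite big_distrl; apply: sumsq_sum => u _ /=.
rewrite big_distrr; apply: sumsq_sum => v _ /=; rewrite -exprMn; exact: sumsq_sqr.
Qed.

Lemma sumsq_nat n : sumsq (n%:R : A).
Proof.
elim: n => [|n IHn]; first exact: sumsq0.
by rewrite -addn1 natrD -[1%:R](expr1n A 2); apply: sumsqD => //; apply: sumsq_sqr.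
Qed.

(** Appending a value z adds the squares of its differences with all earlier values. *)
Lemma sumsq_variance m (v : 'I_m -> A) :
  sumsq (m%:R * (\sum_i v i ^+ 2) - (\sum_i v i) ^+ 2).
Proof.
elim: m v => [|m IHm] v; first by rewrite !big_ord0 mul0r expr2 mul0r subrr; exact: sumsq0.
pose w i := v (widen_ord (leqnSn m) i); pose z := v ord_max.
have -> : m.+1%:R * (\sum_i v i ^+ 2) - (\sum_i v i) ^+ 2 =
    (m%:R * (\sum_i w i ^+ 2) - (\sum_i w i) ^+ 2) + \sum_i (w i - z) ^+ 2.
  have -> : \sum_i (w i - z) ^+ 2 =
      \sum_i w i ^+ 2 - 2 * z * (\sum_i w i) + m%:R * z ^+ 2.
    have -> : m%:R * z ^+ 2 = \sum_(i < m) z ^+ 2.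
      by rewrite sumr_const card_ord mulr_natl.
    by rewrite mulr_sumr -sumrB -big_split /=; apply: eq_bigr => i _; ring.
  rewrite !big_ord_recr /= -/z -natr1.
  by rewrite -[\sum_i v _ ^+ 2]/(\sum_i w i ^+ 2) -[\sum_i v _]/(\sum_i w i); ring.
by apply: sumsqD => //; apply: sumsq_sum => i _; apply: sumsq_sqr.
Qed.

End SumsOfSquares.

Lemma sumsq_rmorph (A B : comNzRingType) (f : {rmorphism A -> B}) (p : A) :
  sumsq p -> sumsq (f p).
Proof.
move=> [s ->]; rewrite rmorph_sum; apply: sumsq_sum => q _.
by rewrite rmorphXn; apply: sumsq_sqr.
Qed.

(** * Quadratic and cubic forms attached to a graph *)

Section GraphForms.
Variable G : sgraph.

Definition adj (u v : G) : bool := (u == v) || edge u v.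

Lemma adj_sym u v : adj u v = adj v u.
Proof. by rewrite /adj eq_sym edge_sym. Qed.

Lemma in_closed_nbhd u v : (v \in closed_nbhd u) = adj u v.
Proof. by rewrite in_setU1 inE /adj eq_sym. Qed.

Variable A : comNzRingType.
Implicit Type f : G -> A.

Definition quad f : A := \sum_u \sum_v (adj u v)%:R * f u * f v.

Definition motzkin_straus (c : A) f : A := c * quad f - (\sum_u f u) ^+ 2.

Lemma sumsq_quad f : (forall u, sumsq (f u)) -> sumsq (quad f).
Proof.
move=> sqf; apply: sumsq_sum => u _; apply: sumsq_sum => v _.
by do !apply: sumsqM => //; apply: sumsq_nat.
Qed.

(** This is X_u of the overview; [far_quad] is D_u and [induced_path_sum] is N. *)
Definition nbhd_sum f u : A := \sum_v (adj u v)%:R * f v.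

Definition far_quad f u : A :=
  \sum_v \sum_w (~~ adj u v && ~~ adj u w && adj v w)%:R * f v * f w.

(** Since [adj] is reflexive, the condition forces u, v, w to be distinct: they induce a path with
    middle vertex u. *)
Definition induced_path_sum f : A :=
  \sum_u \sum_v \sum_w (adj u v && adj u w && ~~ adj v w)%:R * f u * f v * f w.

Lemma sumsq_induced_path_sum f : (forall u, sumsq (f u)) -> sumsq (induced_path_sum f).
Proof.
move=> sqf; do 3![apply: sumsq_sum => ? _].
by do !apply: sumsqM => //; apply: sumsq_nat.
Qed.

Lemma sum_nbhd f : \sum_u f u * nbhd_sum f u = quad f.
Proof.
by apply: eq_bigr => u _; rewrite mulr_sumr; apply: eq_bigr => v _; ring.
Qed.

(* Each triple of indices is counted up to relabelling: for symmetric [adj] the three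
   sums over paths u-v-w with a prescribed middle vertex coincide. *)
Lemma sum_far_quad f :
  \sum_u f u * far_quad f u + \sum_u f u * nbhd_sum f u ^+ 2 + induced_path_sum f =
  (\sum_u f u) * quad f.
Proof.
pose S3 (c : G -> G -> G -> nat) : A := \sum_u \sum_v \sum_w (c u v w)%:R * f u * f v * f w.
have S3C c : S3 c = S3 (fun v u w => c u v w).
  by rewrite /S3 exchange_big /=; do 3![apply: eq_bigr => ? _]; ring.
have S3C' c : S3 c = S3 (fun u w v => c u v w).
  rewrite /S3; apply: eq_bigr => u _; rewrite exchange_big /=.
  by do 2![apply: eq_bigr => ? _]; ring.
have T3E : \sum_u f u * nbhd_sum f u ^+ 2 = S3 (fun u v w => adj u v && adj u w).
  apply: eq_bigr => u _; rewrite expr2 big_distrlr mulr_sumr.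
  apply: eq_bigr => v _; rewrite mulr_sumr; apply: eq_bigr => w _.
  by rewrite -mulnb natrM /=; ring.
have farE : \sum_u f u * far_quad f u =
    S3 (fun u v w => ~~ adj u v && ~~ adj u w && adj v w).
  apply: eq_bigr => u _; rewrite mulr_sumr; apply: eq_bigr => v _; rewrite mulr_sumr.
  by apply: eq_bigr => w _; ring.
have allE : (\sum_u f u) * quad f = S3 (fun u v w => adj v w).
  rewrite mulr_suml; apply: eq_bigr => u _; rewrite mulr_sumr; apply: eq_bigr => v _.
  by rewrite mulr_sumr; apply: eq_bigr => w _; ring.
have S3v : S3 (fun u v w => adj u v && adj u w) = S3 (fun u v w => adj u v && adj v w).
  by rewrite S3C; do 3![apply: eq_bigr => ? _]; rewrite adj_sym.
have S3w : S3 (fun u v w => adj u v && adj u w) = S3 (fun u v w => adj u w && adj v w).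
  rewrite S3v S3C'; apply: eq_bigr => u _; apply: eq_bigr => v _.
  by apply: eq_bigr => w _; rewrite (adj_sym w v).
have S3D c d : S3 c + S3 d = S3 (fun u v w => c u v w + d u v w)%N.
  rewrite /S3 -!big_split; apply: eq_bigr => u _; rewrite -!big_split.
  apply: eq_bigr => v _; rewrite -!big_split; apply: eq_bigr => w _.
  by rewrite /= -!mulrDl -natrD.
(* Equal sums, written over different middle vertices, are added to both sides so that the identity
   holds coefficient by coefficient, for all eight adjacency patterns of u, v, w. *)
have key : \sum_u f u * far_quad f u + \sum_u f u * nbhd_sum f u ^+ 2 +
    induced_path_sum f + S3 (fun u v w => adj u v && adj v w) +
    S3 (fun u v w => adj u w && adj v w) =
    (\sum_u f u) * quad f + S3 (fun u v w => adj u v && adj u w) +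
    S3 (fun u v w => adj u v && adj u w).
  rewrite farE T3E allE -[induced_path_sum f]/(S3 (fun u v w => adj u v && adj u w && ~~ adj v w)).
  rewrite !S3D; do 3![apply: eq_bigr => ? _]; congr (_%:R * _ * _ * _).
  by case: (adj _ _); case: (adj _ _); case: (adj _ _).
by move: key; rewrite -S3v -S3w => /addIr/addIr.
Qed.

End GraphForms.

(** * The sum of squares identity behind the upper bound *)

Section IsolatedNodes.
Variables (A : comNzRingType) (H : sgraph) (m : nat).
Variables (f : H -> A) (y : 'I_m -> A).

Let s := \sum_u f u.
Let t := \sum_j y j.
Let Y2 := \sum_j y j ^+ 2.

Lemma sum_affine (c b : A) : \sum_j (c * y j - b) = c * t - m%:R * b.
Proof.
rewrite sumrB -mulr_sumr sumr_const card_ord; congr (_ - _).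
by rewrite mulr_natl.
Qed.

Lemma sum_affine_sqr (c b : A) :
  \sum_j (c * y j - b) ^+ 2 = c ^+ 2 * Y2 - 2 * c * b * t + m%:R * b ^+ 2.
Proof.
have -> : m%:R * b ^+ 2 = \sum_(j < m) b ^+ 2.
  by rewrite sumr_const card_ord mulr_natl.
rewrite !mulr_sumr -sumrB -big_split /=; apply: eq_bigr => j _; ring.
Qed.

(* The identity of the header, multiplied by 4 k^3 (k - 1) to clear denominators: [W] and
   [P] below are k^2 and 4 k^3 (k - 1) times those of the header. *)
Lemma sumsq_isolated (k k1 d : nat) :
    k = k1.+1 -> (4 * k = k1 * m + d)%N ->
    (forall u, sumsq (f u)) -> (forall j, sumsq (y j)) ->
    (forall u, sumsq (k1%:R * far_quad f u - (s - nbhd_sum f u) ^+ 2)) ->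
  sumsq ((4 * k ^ 3 * k1)%:R *
         ((s + t) * ((k + m)%:R * (quad f + Y2) - (s + t) ^+ 2))).
Proof.
move=> kE dE sqf sqy sq_far.
pose kk : A := k%:R; pose mm : A := m%:R; pose a := kk + mm.
have k1E : k1%:R = kk - 1 :> A by rewrite /kk kE -natr1 addrK.
have dA : d%:R = 4 * kk - (kk - 1) * mm.
  have := congr1 (fun n => n%:R : A) dE.
  by rewrite natrD !natrM k1E -/kk -/mm => ->; ring.
pose affine_var c b := mm * (\sum_j (c * y j - b) ^+ 2) - (\sum_j (c * y j - b)) ^+ 2.
have sq_var c b : sumsq (affine_var c b) by exact: sumsq_variance.
pose W := kk * (\sum_j (kk * y j - s) ^+ 2) + affine_var kk s.
(* The shift in the first squares is chosen to produce every term linear in [t]. [affine_var 1 _] is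
   invariant under translation and supplies the [t ^+ 2] term with the rest of [Y2]. *)
pose P u :=
  k1%:R * (\sum_j (2 * kk ^+ 2 * y j -
     (2 * kk ^+ 2 * nbhd_sum f u + (3 * kk + mm) * (s - kk * nbhd_sum f u))) ^+ 2)
  + (4 * kk ^+ 3 * k1%:R) * affine_var 1 (nbhd_sum f u)
  + a ^+ 2 * (d%:R * (s - kk * nbhd_sum f u) ^+ 2)
  + (4 * kk ^+ 2 * a ^+ 2) * (k1%:R * far_quad f u - (s - nbhd_sum f u) ^+ 2).
have sqW : sumsq W.
  apply: sumsqD => //; apply: sumsqM; first exact: sumsq_nat.
  by apply: sumsq_sum => j _; apply: sumsq_sqr.
have sq_nat n : sumsq (n%:R : A) by exact: sumsq_nat.
have sq_kk n : sumsq (kk ^+ n) by rewrite -natrX.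
have sq_a : sumsq (a ^+ 2) by exact: sumsq_sqr.
have sqP u : sumsq (P u).
  do !apply: sumsqD.
  - by apply: sumsqM => //; apply: sumsq_sum => j _; apply: sumsq_sqr.
  - by do !apply: sumsqM => //.
  - by apply: sumsqM => //; apply: sumsqM => //; apply: sumsq_sqr.
  - by do !apply: sumsqM => //.
have PE u : P u = 4 * kk ^+ 2 * (kk - 1) *
    (a ^+ 2 * nbhd_sum f u ^+ 2 - mm * a * nbhd_sum f u * s
     + a * kk * nbhd_sum f u * t - (3 * kk + mm) * s * t + a * kk * Y2
     - kk * t ^+ 2 + a ^+ 2 * far_quad f u - kk * s ^+ 2).
  rewrite /P /affine_var !sum_affine_sqr sum_affine k1E dA /a -/mm; ring.
have WE : W = kk * (a * kk * Y2 - kk * t ^+ 2 - 2 * kk * s * t + mm * s ^+ 2).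
  rewrite /W /affine_var !sum_affine_sqr sum_affine /a -/mm; ring.
(* In [P u] the square of [nbhd_sum f u] and [far_quad f u] carry the same coefficient, so
   [sum_far_quad] can replace both sums at once. *)
have sum_lin (c p b e : A) :
    \sum_u f u * (c * (p * (nbhd_sum f u ^+ 2 + far_quad f u) + b * nbhd_sum f u + e)) =
    c * (p * (\sum_u f u * nbhd_sum f u ^+ 2 + \sum_u f u * far_quad f u)
         + b * (\sum_u f u * nbhd_sum f u) + e * s).
  by rewrite -big_split /s !mulr_sumr -!big_split mulr_sumr /=; apply: eq_bigr => u _; ring.
have -> : (4 * k ^ 3 * k1)%:R *
         ((s + t) * ((k + m)%:R * (quad f + Y2) - (s + t) ^+ 2)) =
  \sum_u f u * P u + 4 * kk * k1%:R * (t * W)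
  + 4 * kk ^+ 2 * k1%:R * (a ^+ 2 * induced_path_sum f).
  pose c := 4 * kk ^+ 2 * (kk - 1).
  have -> : \sum_u f u * P u = c * (
     a ^+ 2 * (\sum_u f u * nbhd_sum f u ^+ 2 + \sum_u f u * far_quad f u)
     + (a * kk * t - mm * a * s) * (\sum_u f u * nbhd_sum f u)
     + (a * kk * Y2 - (3 * kk + mm) * s * t - kk * t ^+ 2 - kk * s ^+ 2) * s).
    rewrite -sum_lin; apply: eq_bigr => u _; rewrite PE /c; ring.
  have -> : \sum_u f u * nbhd_sum f u ^+ 2 + \sum_u f u * far_quad f u =
      s * quad f - induced_path_sum f.
    by rewrite /s -sum_far_quad addrK addrC.
  rewrite sum_nbhd WE.
  rewrite !natrM natrD !k1E -/kk -/mm /c /a; ring.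
do !apply: sumsqD.
- by apply: sumsq_sum => u _; apply: sumsqM.
- apply: sumsqM; first by rewrite /kk -!natrM.
  by apply: sumsqM => //; apply: sumsq_sum.
- apply: sumsqM; first by rewrite /kk -natrX -!natrM.
  by apply: sumsqM => //; apply: sumsq_induced_path_sum.
Qed.

End IsolatedNodes.

(** * Cone membership as a sum of squares, and its specializations *)

Lemma rmorph_motzkin_straus (A B : comNzRingType) (phi : {rmorphism A -> B})
    (G : sgraph) (c : A) (f : G -> A) :
  phi (motzkin_straus c f) = motzkin_straus (phi c) (phi \o f).
Proof.
rewrite /motzkin_straus rmorphB rmorphM rmorphXn !rmorph_sum; congr (_ * _ - _).
apply: eq_bigr => u _; rewrite rmorph_sum; apply: eq_bigr => v _.
by rewrite !rmorphM rmorph_nat.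
Qed.

Lemma eq_motzkin_straus (A : comNzRingType) (G : sgraph) (c : A) (f g : G -> A) :
  f =1 g -> motzkin_straus c f = motzkin_straus c g.
Proof.
move=> fg; rewrite /motzkin_straus (eq_bigr _ (fun u _ => fg u)); congr (_ * _ - _).
by apply: eq_bigr => u _; apply: eq_bigr => v _; rewrite !fg.
Qed.

Section Membership.
Variables (R : realType) (G : sgraph).

Definition vertex_sqr (u : G) : {mpoly R[#|G|]} := 'X_(enum_rank u) ^+ 2.

Lemma sum_vertices (V : nmodType) (F : 'I_#|G| -> V) :
  \sum_i F i = \sum_(u : G) F (enum_rank u).
Proof. by rewrite (reindex _ (onW_bij _ (enum_rank_bij G))). Qed.

Lemma graph_matrix_form :
  \sum_(i < #|G|) \sum_(j < #|G|) graph_matrix R G i j *: ('X_i ^+ 2 * 'X_j ^+ 2) =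
  motzkin_straus (alpha G)%:R vertex_sqr.
Proof.
rewrite sum_vertices /motzkin_straus expr2 big_distrlr mulr_sumr -sumrB.
apply: eq_bigr => u _; rewrite sum_vertices mulr_sumr -sumrB; apply: eq_bigr => v _.
rewrite !mxE !enum_rankK (inj_eq enum_rank_inj) /adj -/(vertex_sqr u) -/(vertex_sqr v).
have -> : (edge u v)%:R + (u == v)%:R = ((u == v) || edge u v)%:R :> R.
  by have [->|_] := eqVneq u v; rewrite ?edge_irr ?add0r ?addr0.
rewrite scalerBl scale1r; congr (_ - _).
by rewrite -natrM scaler_nat -!mulrA !mulr_natl -mulrnA mulnC.
Qed.

Lemma graph_matrix_sym : (graph_matrix R G)^T = graph_matrix R G.
Proof.
apply/matrixP => i j; rewrite !mxE edge_sym; congr (_ * (_ + _) - _).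
by rewrite eq_sym.
Qed.

Lemma KconeP r : Kcone r (graph_matrix R G) <->
  sumsq ((\sum_u vertex_sqr u) ^+ r * motzkin_straus (alpha G)%:R vertex_sqr).
Proof.
rewrite /Kcone graph_matrix_sym graph_matrix_form sum_vertices.
by split=> [[_]|].
Qed.

(** Sums of squares survive substitution. Used to read a certificate for an induced subgraph in the
    variables of [G], and to identify the variables of the isolated nodes. *)
Lemma Kcone0_eval (B : comNzRingType) (h : {rmorphism R -> B}) (g : G -> B) :
  Kcone 0 (graph_matrix R G) -> sumsq (motzkin_straus (alpha G)%:R (fun u => g u ^+ 2)).
Proof.
move=> /KconeP; rewrite expr0 mul1r => sq.
pose phi : {rmorphism {mpoly R[#|G|]} -> B} := mmap h (g \o enum_val).
have := sumsq_rmorph phi sq; rewrite rmorph_motzkin_straus rmorph_nat.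
rewrite (@eq_motzkin_straus _ _ _ _ (fun u => g u ^+ 2)) // => u /=.
by rewrite rmorphXn /phi /= mmapX mmap1U /= enum_rankK.
Qed.

Lemma theta_rankP r : theta_rank R G = Some r <->
  Kcone r (graph_matrix R G) /\ forall r', Kcone r' (graph_matrix R G) -> (r <= r')%N.
Proof.
rewrite /theta_rank; case: pselect => [ex_r|no_r]; last first.
  by split=> // -[Kr _]; case: no_r; exists r; apply/asboolP.
case: ex_minnP => n /asboolP Kn min_n; split=> [[<-]|[Kr min_r]].
  by split=> // r' Kr'; apply/min_n/asboolP.
by congr Some; apply/eqP; rewrite eqn_leq min_r // min_n //; apply/asboolP.
Qed.

End Membership.

(** * Stability numbers *)

Lemma stableP (G : sgraph) (S : {set G}) :
  reflect {in S &, forall x y, ~~ edge x y} (stable S).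
Proof.
apply: (iffP forall_inP) => [S_stable x y xS yS|S_stable x xS].
  by have /forall_inP := S_stable x xS; apply.
by apply/forall_inP => y yS; apply: S_stable.
Qed.

Lemma card_stable_le_alpha (G : sgraph) (S : {set G}) : stable S -> (#|S| <= alpha G)%N.
Proof. exact: (@leq_bigmax_cond _ _ (fun S : {set G} => #|S|)). Qed.

Lemma exists_max_stable (G : sgraph) : exists2 S : {set G}, stable S & #|S| = alpha G.
Proof.
have stable0 : stable (set0 : {set G}) by apply/stableP => x y; rewrite inE.
rewrite /alpha (bigop.bigmax_eq_arg set0 stable0); case: arg_maxnP => // S S_stable _.
by exists S.
Qed.

Lemma alpha_dunion_edgeless (H : sgraph) m :
  alpha (dunion H (edgeless m)) = (alpha H + m)%N.
Proof.
pose G := dunion H (edgeless m).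
have cardG (S : {set G}) :
    #|S| = (#|[set u : H | inl u \in S]| + #|[set j : 'I_m | inr j \in S]|)%N.
  by rewrite -sum1_card big_sumType -!sum1dep_card.
apply/eqP; rewrite eqn_leq; apply/andP; split.
  apply/bigmax_leqP => S /stableP S_stable; rewrite cardG leq_add //; last first.
    by rewrite -[leqRHS]card_ord max_card.
  apply: card_stable_le_alpha; apply/stableP => u v; rewrite !inE => uS vS.
  exact: S_stable _ _ uS vS.
have [S /stableP S_stable <-] := exists_max_stable H.
pose T := [set x : G | if x is inl u then u \in S else true].
have <- : #|T| = (#|S| + m)%N.
  rewrite cardG; congr (_ + _)%N; first by apply: eq_card => u; rewrite !inE.
  by rewrite -[RHS]card_ord; apply: eq_card => j; rewrite !inE.
apply: card_stable_le_alpha; apply/stableP => -[u|i] [v|j]; rewrite !inE //=.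
exact: S_stable.
Qed.

(** A stable set avoiding the closed neighbourhood of [i] stays stable when [i] is added. *)
Lemma alpha_del_closed_nbhd (G : sgraph) (i : G) :
  (alpha (del_closed_nbhd i) < alpha G)%N.
Proof.
have [S /stableP S_stable <-] := exists_max_stable (del_closed_nbhd i).
have far w : w \in val @: S -> ~~ adj i w.
  by move=> /imsetP[u _ ->]; have := valP u; rewrite inE in_closed_nbhd.
have iS : i \notin val @: S by apply/negP => /far; rewrite /adj eqxx.
have <- : #|i |: val @: S| = #|S|.+1 by rewrite cardsU1 iS (card_imset _ val_inj).
apply: card_stable_le_alpha; apply/stableP => x y.
rewrite !in_setU1 => /orP[/eqP->|xS] /orP[/eqP->|yS]; rewrite ?edge_irr //.
- by have := far _ yS; rewrite negb_or => /andP[].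
- by have := far _ xS; rewrite edge_sym negb_or => /andP[].
by case/imsetP: xS yS => u uS -> /imsetP[v vS ->]; apply: S_stable uS vS.
Qed.

(** * Forms on disjoint unions and on induced subgraphs *)

Section Forms.
Variable A : comNzRingType.

Lemma quad_dunion_edgeless (H : sgraph) m (f : dunion H (edgeless m) -> A) :
  quad f = quad (fun u : H => f (inl u)) + \sum_(j < m) f (inr j) ^+ 2.
Proof.
rewrite /quad big_sumType /=; congr (_ + _); apply: eq_bigr => u _; rewrite big_sumType /=.
  rewrite [X in _ + X]big1 ?addr0 // => j _; by rewrite /adj /= !mul0r.
rewrite big1 ?add0r => [|v _]; last by rewrite /adj /= !mul0r.
rewrite (bigD1 u) //= /adj eqxx mul1r big1 ?addr0 // => j /negbTE ju.
by rewrite (inj_eq inr_inj) eq_sym ju /= !mul0r.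
Qed.

Lemma sum_dunion_edgeless (H : sgraph) m (f : dunion H (edgeless m) -> A) :
  \sum_x f x = \sum_(u : H) f (inl u) + \sum_(j < m) f (inr j).
Proof. by rewrite big_sumType. Qed.

Lemma sum_del_closed_nbhd (G : sgraph) (i : G) (F : G -> A) :
  \sum_(w : del_closed_nbhd i) F (val w) = \sum_v (~~ adj i v)%:R * F v.
Proof.
rewrite -(big_sub (mem (~: closed_nbhd i)) F) big_mkcond; apply: eq_bigr => v _.
by rewrite /= inE in_closed_nbhd; case: adj; rewrite ?mul0r ?mul1r.
Qed.

Lemma quad_del_closed_nbhd (G : sgraph) (i : G) (f : G -> A) :
  quad (fun w : del_closed_nbhd i => f (val w)) = far_quad f i.
Proof.
pose F v := \sum_(w : del_closed_nbhd i) (adj v (val w))%:R * f v * f (val w).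
rewrite /quad -[LHS]/(\sum_(v : del_closed_nbhd i) F (val v)) sum_del_closed_nbhd.
apply: eq_bigr => v _.
rewrite /F (sum_del_closed_nbhd i (fun w => (adj v w)%:R * f v * f w)) mulr_sumr.
apply: eq_bigr => w _; rewrite -!mulnb !natrM; ring.
Qed.

Lemma sum_del_nbhd_sum (G : sgraph) (i : G) (f : G -> A) :
  \sum_(w : del_closed_nbhd i) f (val w) = \sum_u f u - nbhd_sum f i.
Proof.
rewrite sum_del_closed_nbhd -sumrB; apply: eq_bigr => v _.
by case: adj; rewrite ?mul0r ?mul1r ?subrr ?subr0.
Qed.

End Forms.

(** * Even parts of univariate polynomials *)

Section EvenPart.
Variable A : comNzRingType.

Lemma even_poly_comp_sqr (p : {poly A}) : even_poly (p \Po 'X^2) = p.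
Proof.
apply/polyP => i; rewrite coef_even_poly coef_comp_poly_Xn // -muln2.
by rewrite dvdn_mull // mulnK.
Qed.

Lemma odd_poly_comp_sqr (p : {poly A}) : odd_poly (p \Po 'X^2) = 0.
Proof.
apply/polyP => i; rewrite coef_odd_poly coef_comp_poly_Xn // coef0.
by rewrite dvdn2 /= odd_double.
Qed.

(* Substituting [c] for the square of the variable: in the even part of [q ^ 2]
   the square of the odd part of [q] appears multiplied by this square. *)
Lemma sumsq_even_poly (p : {poly A}) (c : A) :
  sumsq p -> sumsq c -> sumsq (even_poly p).[c].
Proof.
move=> [s ->] sqc; rewrite raddf_sum horner_sum; apply: sumsq_sum => q _ /=.
pose e := even_poly q; pose o := odd_poly q.
have -> : q ^+ 2 = (e ^+ 2 + 'X * o ^+ 2) \Po 'X^2 + ((e * o + e * o) \Po 'X^2) * 'X.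
  rewrite -{1}(poly_even_odd q) -/e -/o.
  rewrite !comp_polyD !expr2 !comp_polyM comp_polyX -expr2; ring.
rewrite even_polyD even_polyMX even_poly_comp_sqr odd_poly_comp_sqr mul0r addr0.
rewrite !expr2 hornerD !hornerM hornerX -!expr2; apply: sumsqD; first exact: sumsq_sqr.
by apply: sumsqM => //; apply: sumsq_sqr.
Qed.

End EvenPart.

(** * The two bounds for the graph with isolated nodes *)

(** The constant 1/n is the square of a real number; this undoes the clearing of denominators. *)
Lemma sumsq_divn (R : realType) N n (p : {mpoly R[N]}) :
  (0 < n)%N -> sumsq (n%:R * p) -> sumsq p.
Proof.
move=> n_gt0 sq; have -> : p = ((Num.sqrt n%:R^-1)%:MP : {mpoly R[N]}) ^+ 2 * (n%:R * p).
  rewrite expr2 -mpolyCM -expr2 sqr_sqrtr ?invr_ge0 ?ler0n // mulrA -mpolyC_nat -mpolyCM.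
  by rewrite mulVf ?mul1r // pnatr_eq0 -lt0n.
by apply: sumsqM => //; apply: sumsq_sqr.
Qed.

Section AddingIsolatedNodes.
Variables (R : realType) (H : sgraph) (m : nat).
Let G := dunion H (edgeless m).

Lemma Kcone0_dunion_edgeless :
  (0 < alpha H)%N -> Kcone 0 (graph_matrix R G) -> Kcone 0 (graph_matrix R H).
Proof.
move=> alpha_gt0 K0.
pose A := {mpoly R[#|H|]}; pose f := @vertex_sqr R H.
pose g (x : G) : {poly A} := if x is inl u then ('X_(enum_rank u))%:P else 'X.
pose h : {rmorphism R -> {poly A}} := polyC \o @mpolyC _ R.
have := Kcone0_eval h g K0; rewrite alpha_dunion_edgeless.
set k := alpha H; set p := motzkin_straus _ _ => sq_p.
pose s := \sum_u f u.
pose F : {poly A} :=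
  (k + m)%:R%:P * ((quad f)%:P + m%:R%:P * 'X^2) - (s%:P + m%:R%:P * 'X) ^+ 2.
have pE : p = F \Po 'X^2.
  rewrite /F raddfB /= [in RHS]expr2 !(comp_polyM, comp_polyD, comp_polyC, comp_Xn_poly).
  rewrite comp_polyX -expr2 !polyC_natr /p /motzkin_straus.
  rewrite quad_dunion_edgeless sum_dunion_edgeless /=.
  have sum_const (c : {poly A}) : \sum_(j < m) c = m%:R * c.
    by rewrite sumr_const card_ord mulr_natl.
  rewrite !sum_const; congr (_ * (_ + _) - (_ + _) ^+ 2).
    rewrite /quad !rmorph_sum; apply: eq_bigr => u _; rewrite rmorph_sum.
    by apply: eq_bigr => v _; rewrite /= !expr2 !polyCM polyC_natr.
  by rewrite /s rmorph_sum; apply: eq_bigr => u _; rewrite /= /f /vertex_sqr polyC_exp.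
pose e : A := (k%:R^-1)%:MP.
have ke : k%:R * e = 1.
  by rewrite -mpolyC_nat -mpolyCM mulfV // pnatr_eq0 -lt0n.
have sq_e : sumsq e.
  have -> : e = k%:R * e ^+ 2 by rewrite expr2 mulrA ke mul1r.
  by apply: sumsqM; [apply: sumsq_nat|apply: sumsq_sqr].
have sq_s : sumsq s by apply: sumsq_sum => u _; apply: sumsq_sqr.
(* The value s / k substituted for the squared variable is the one minimizing [F]. *)
have := sumsq_even_poly sq_p (sumsqM sq_s sq_e).
rewrite pE even_poly_comp_sqr => sq_F.
apply/KconeP; rewrite expr0 mul1r -/k.
apply: (@sumsq_divn _ _ ((k + m) * k)%N); first by rewrite muln_gt0 addn_gt0 alpha_gt0.
have -> : ((k + m) * k)%:R * motzkin_straus k%:R f = k%:R ^+ 2 *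
  ((k + m)%:R * (quad f + m%:R * (s * e) ^+ 2) - (s + m%:R * (s * e)) ^+ 2).
  rewrite /motzkin_straus -/s natrM natrD.
  have -> : k%:R ^+ 2 * ((k%:R + m%:R) * (quad f + m%:R * (s * e) ^+ 2)
     - (s + m%:R * (s * e)) ^+ 2) = k%:R ^+ 2 * (k%:R + m%:R) * quad f
     + (k%:R + m%:R) * m%:R * s ^+ 2 * (k%:R * e) ^+ 2
     - s ^+ 2 * (k%:R + m%:R * (k%:R * e)) ^+ 2 by ring.
  rewrite ke; ring.
apply: sumsqM; first exact: sumsq_sqr.
suff <- : F.[s * e] = (k + m)%:R * (quad f + m%:R * (s * e) ^+ 2) -
    (s + m%:R * (s * e)) ^+ 2 by [].
by rewrite /F hornerD hornerN hornerCM hornerD hornerC hornerCM hornerXn expr2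
  hornerM hornerD hornerC hornerCM hornerX -expr2.
Qed.

(** Here [d] is the slack 4 k - (k - 1) m; its being a natural number encodes the bound on the
    number of isolated nodes. *)
Lemma Kcone1_dunion_edgeless (k1 d : nat) :
    alpha H = k1.+1 -> (0 < k1)%N -> (4 * k1.+1 = k1 * m + d)%N ->
    (forall i : H, Kcone 0 (graph_matrix R (del_closed_nbhd i))) ->
  Kcone 1 (graph_matrix R G).
Proof.
move=> alphaH k1_gt0 dE K0; apply/KconeP.
rewrite expr1 alpha_dunion_edgeless alphaH /motzkin_straus.
rewrite quad_dunion_edgeless !sum_dunion_edgeless.
pose f (u : H) := vertex_sqr R (inl u : G); pose y j := vertex_sqr R (inr j : G).
apply: (@sumsq_divn _ _ (4 * k1.+1 ^ 3 * k1)%N); first by rewrite !muln_gt0 k1_gt0.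
apply: (@sumsq_isolated _ H m f y _ _ d) => //.
- by move=> u; apply: sumsq_sqr.
- by move=> j; apply: sumsq_sqr.
move=> u; pose g (w : del_closed_nbhd u) : {mpoly R[#|G|]} := 'X_(enum_rank (inl (val w) : G)).
have := Kcone0_eval (@mpolyC _ R) g (K0 u); rewrite /motzkin_straus.
rewrite -[quad _]/(quad (fun w : del_closed_nbhd u => f (val w))) quad_del_closed_nbhd.
rewrite -[\sum_w _]/(\sum_(w : del_closed_nbhd u) f (val w)) sum_del_nbhd_sum.
have := alpha_del_closed_nbhd u; rewrite alphaH ltnS => le_k1 sq.
(* The stability number of the induced subgraph may be smaller than [k1]; the difference multiplies
   [far_quad f u], itself a sum of squares. *)
rewrite -(subnK le_k1) natrD mulrDl -addrA; apply: sumsqD => //.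
apply: sumsqM; first exact: sumsq_nat.
by rewrite -quad_del_closed_nbhd; apply: sumsq_quad => w; apply: sumsq_sqr.
Qed.

End AddingIsolatedNodes.

Theorem theorem6p13 (R : realType) (a k : nat) (H : sgraph)
    (hk : (2 <= k)%N) (hka : (k <= a)%N)
    (halphaH : alpha H = k)
    (hlocal : forall i : H, theta_rank R (del_closed_nbhd i) = Some 0%N)
    (hrankH : theta_rank R H = Some 1%N)
    (ha : a%:R <= k%:R * (k%:R + 3) / (k%:R - 1) :> R) :
  theta_rank R (dunion H (edgeless (a - k))) = Some 1%N.
Proof.
have nat_ha : (a * k.-1 <= k * (k + 3))%N.
  rewrite -(ler_nat R) !natrM natrD -subn1 natrB ?(ltnW hk) //.
  by rewrite -ler_pdivlMr ?subr_gt0 ?ltr1n.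
have [k1_gt0 kE] : (0 < k.-1)%N /\ k = k.-1.+1 by lia.
(* [nat_ha] amounts to (k - 1) (a - k) <= 4 k, so the truncated subtraction is exact. *)
have dE : (4 * k.-1.+1 = k.-1 * (a - k) + (4 * k - k.-1 * (a - k)))%N by nia.
apply/theta_rankP; split=> [|[|//] K0].
  apply: Kcone1_dunion_edgeless dE _ => //; first by rewrite halphaH.
  by move=> i; have /theta_rankP[] := hlocal i.
have /theta_rankP[_ min1] := hrankH; apply: min1.
by apply: Kcone0_dunion_edgeless K0; rewrite halphaH; lia.
Qed.
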